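(* Let $f_{\mathrm{swsr}}^s$ be the solution of the semi-discrete Vlasov-Poisson equations in the symmetrically weighted (SW) square-root formulation, as given in the context. Then the number of particles $\mathcal{N}^s(t)=\int_0^\ell\int_{\mathbb{R}}f_{\mathrm{swsr}}^s(x,v,t)\,\mathrm{d}v\,\mathrm{d}x$ of each plasma species $s$ is conserved in time, i.e. $\frac{\mathrm{d}\mathcal{N}^s}{\mathrm{d}t}=0$.
   Context: Finitely many species $s$ have constants $q^s,u^s\in\mathbb{R}$ and $m^s,\alpha^s>0$; $N_v\ge1$ is the number of velocity modes. The spatial domain $[0,\ell]$ is periodic, with a uniform grid $x^{(1)},\dots,x^{(N_x)}$, spacing $\Delta x=\ell/N_x$. Basis: $\psi_n(\xi)=(\sqrt\pi2^nn!)^{-1/2}\mathcal H_n(\xi)e^{-\xi^2/2}$ with physicists' Hermite polynomials $\mathcal H_n$, $\xi^s=(v-u^s)/\alpha^s$. $\mathbf{D}^p\in\mathbb{R}^{N_x\times N_x}$ is the periodic centered finite difference matrix of even order $p$ ($N_x>p$): the circulant matrix $\mathbf{D}^p_{jk}=d^p_{(k-j)\bmod N_x}$ with $d_0^p=0$; for $1\le k\le p/2=:r$, $d_k^p=\frac{1}{\Delta x}\frac{(-1)^{k+1}(r!)^2}{k(r-k)!(r+k)!}$ and $d_{N_x-k}^p=-d_k^p$; all other $d_k^p=0$. Semi-discrete SW square-root system: differentiable functions $\mathbf{C}_n^s(t)\in\mathbb{R}^{N_x}$ ($0\le n\le N_v-1$; convention $\mathbf C_{-1}^s=\mathbf C_{N_v}^s=0$)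 and $\mathbf E(t)\in\mathbb{R}^{N_x}$ with $$\frac{\mathrm d\mathbf C_n^s}{\mathrm dt}=-\mathbf D^p\Big(\alpha^s\sqrt{\tfrac n2}\,\mathbf C_{n-1}^s+\alpha^s\sqrt{\tfrac{n+1}2}\,\mathbf C_{n+1}^s+u^s\mathbf C_n^s\Big)+\frac{q^s}{m^s\alpha^s}\mathbf E\odot\Big(\sqrt{\tfrac n2}\,\mathbf C_{n-1}^s-\sqrt{\tfrac{n+1}2}\,\mathbf C_{n+1}^s\Big),$$ $$\mathbf D^p\mathbf E(t)=\sum_sq^s\alpha^s\sum_{n=0}^{N_v-1}\mathbf C_n^s(t)^2,\qquad \mathbf 1^\top\mathbf E(t)=0,$$ where $\odot$ is the entrywise product, $\mathbf C^2=\mathbf C\odot\mathbf C$, and $\mathbf 1$ is the all-ones vector. The solution is $f^s_{\mathrm{swsr}}(x^{(j)},v,t)=\Big(\sum_{n=0}^{N_v-1}(\mathbf C_n^s(t))_j\,\psi_n(\xi^s)\Big)^2$. All integrals over $x$ are evaluated by the periodic trapezoidal rule $\int_0^\ell g\,\mathrm dx:=\Delta x\sum_jg(x^{(j)})$, so $\mathcal N^s(t)=\Delta x\,\alpha^s\sum_{n=0}^{N_v-1}\mathbf C_n^s(t)^\top\mathbf C_n^s(t)$. *)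

(* Defs.v *)
From HB Require Import structures.
From mathcomp Require Import all_boot all_order all_algebra.
From mathcomp Require Import all_classical all_reals all_analysis.

Set Implicit Arguments.
Unset Strict Implicit.
Unset Printing Implicit Defensive.

Import Order.TTheory GRing.Theory Num.Theory.
Import numFieldNormedType.Exports.

Local Open Scope ring_scope.

(* Physicists' convention: H_0 = 1, H_1 = 2X, H_{n+2} = 2X H_{n+1} - 2(n+1) H_n. *)
Fixpoint hermite (R : realType) (n : nat) : {poly R} :=
  if n is n1.+1 then
    if n1 is n2.+1 then
      2%:R *: ('X * hermite R n1) - (2 * n1)%N%:R *: hermite R n2
    else 2%:R *: 'X
  else 1.

Definition psi (R : realType) (n : nat) (xi : R) : R :=
  (Num.sqrt (Num.sqrt pi * 2 ^+ n * n`!%:R))^-1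
  * (hermite R n).[xi] * expR (- xi ^+ 2 / 2).

Definition grid_spacing (R : realType) (l : R) (Nx : nat) : R := l / Nx%:R.

Definition fd_weight (R : realType) (dx : R) (p k : nat) : R :=
  let r := p./2 in
  dx^-1 * ((-1) ^+ k.+1 * (r`! ^ 2)%N%:R / (k * (r - k)`! * (r + k)`!)%N%:R).

(* First row of the matrix, 0 <= k < Nx. The two nonzero ranges are disjoint as
   soon as p < Nx. *)
Definition fd_coef (R : realType) (dx : R) (p Nx k : nat) : R :=
  if (0 < k <= p./2)%N then fd_weight dx p k
  else if (0 < Nx - k <= p./2)%N then - fd_weight dx p (Nx - k)
  else 0.

(* [k + (Nx - j)] is [k - j] modulo Nx, without truncation since j < Nx. *)
Definition fd_matrix (R : realType) (l : R) (p Nx : nat) : 'M[R]_Nx :=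
  \matrix_(j < Nx, k < Nx)
    fd_coef (grid_spacing l Nx) p Nx ((k + (Nx - j)) %% Nx)%N.

Definition hadamard (R : realType) (m n : nat) (A B : 'M[R]_(m, n)) :
  'M[R]_(m, n) := map2_mx *%R A B.

(* Family of modes indexed by all integers, zero outside 0 <= k < Nv. *)
Definition mode (V : zmodType) (Nv : nat) (c : 'I_Nv -> V) (k : int) : V :=
  if k is Posz n then (if insub n is Some i then c i else 0) else 0.

(* Right-hand side of the evolution equation of the n-th mode of a species
   with parameters q, m, u, alpha, for the modes c and the electric field e
   at a fixed time. *)
Definition swsr_rhs (R : realType) (Nv Nx : nat) (D : 'M[R]_Nx)
    (q m u alpha : R) (c : 'I_Nv -> 'cV[R]_Nx) (e : 'cV[R]_Nx) (n : 'I_Nv) :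
  'cV[R]_Nx :=
  let cm := mode c (n%:Z - 1) in
  let cp := mode c (n%:Z + 1) in
  - (D *m ((alpha * Num.sqrt (n%:R / 2)) *: cm
           + (alpha * Num.sqrt (n.+1%:R / 2)) *: cp
           + u *: c n))
  + (q / (m * alpha))
    *: hadamard e (Num.sqrt (n%:R / 2) *: cm - Num.sqrt (n.+1%:R / 2) *: cp).

(* C and E solve the semi-discrete system at every time of the interval I.
   The derivative is that of C s n on a neighbourhood of t: at an endpoint
   belonging to I a one-sided solution is to be extended differentiably. *)
Record swsr_solution (R : realType) (S : finType) (Nv Nx p : nat) (l : R)
    (q m u alpha : S -> R) (I : interval R)
    (C : S -> 'I_Nv -> R -> 'cV[R]_Nx) (E : R -> 'cV[R]_Nx) : Prop :=
  SwsrSolution {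
    swsr_evolution : forall (s : S) (n : 'I_Nv) (t : R), t \in I ->
      is_derive t 1 (C s n)
        (swsr_rhs (fd_matrix l p Nx) (q s) (m s) (u s) (alpha s)
           (fun k => C s k t) (E t) n);
    swsr_poisson : forall t : R, t \in I ->
      fd_matrix l p Nx *m E t
      = \sum_(s : S) (q s * alpha s)
          *: (\sum_(n < Nv) hadamard (C s n t) (C s n t));
    swsr_neutral : forall t : R, t \in I ->
      (const_mx 1 : 'cV[R]_Nx)^T *m E t = 0
  }.

(* Value at the j-th grid point, velocity v and time t. *)
Definition f_swsr (R : realType) (S : finType) (Nv Nx : nat)
    (u alpha : S -> R) (C : S -> 'I_Nv -> R -> 'cV[R]_Nx)
    (s : S) (j : 'I_Nx) (v t : R) : R :=
  (\sum_(n < Nv) C s n t j 0 * psi n ((v - u s) / alpha s)) ^+ 2.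

(* Functions of x are given by their values on the grid. *)
Definition trapezoid (R : realType) (l : R) (Nx : nat) (g : 'I_Nx -> R) : R :=
  grid_spacing l Nx * \sum_(j < Nx) g j.

Definition particle_number (R : realType) (S : finType) (Nv Nx : nat) (l : R)
    (u alpha : S -> R) (C : S -> 'I_Nv -> R -> 'cV[R]_Nx)
    (s : S) (t : R) : R :=
  trapezoid l (fun j : 'I_Nx =>
    \int[@lebesgue_measure R]_v f_swsr u alpha C s j v t).

(* Main.v *)
Require Import Defs.
From HB Require Import structures.
From mathcomp Require Import all_boot all_order all_algebra.
From mathcomp Require Import all_classical all_reals all_analysis.
From mathcomp Require Import measurable_realfun zify ring lra.

(** The number of particles is a fixed positive multiple of the sum of the
    squared Euclidean norms of the modes, and the semi-discrete flow is a
    rotation in the space of all modes: at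
    each time its generator is skew-symmetric.

    The first half is the orthonormality of the Hermite functions
    ([Rintegral_sqr_hermite_expansion], [particle_numberE]).  For fixed [u] and
    [a], integrating [p ((v - u) / a) * exp (- ((v - u) / a) ^ 2)] over [v] is a
    linear functional [gauss_moment] of the polynomial [p].  Integration by parts
    says that it vanishes on [p' - 2 X p] ([gauss_moment_parts]), and that alone
    makes Hermite polynomials orthogonal for it ([hermite_orthogonal]): since
    [H_(i+1) = 2 X H_i - H_i'], one has [L (H_(i+1) g) = L (H_i g')], so the
    degrees of both factors go down together until one of them is constant.
    Working with the rescaled functional from the start avoids a change of
    variables.

    For the second half, write the equation of the mode [c_n] with
    [A = kappa * diag e - alpha * D].  Centered differences make [D]
    skew-symmetric ([fd_matrix_skew]) while [diag e] is symmetric, so the term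
    coming from [c_(n+1)] is the opposite of the one through which [c_n] acts on
    [c_(n+1)].  Hence [c_n^T c_n'] is the difference of two consecutive fluxes
    ([mode_mul_rhs]), the advection by [u] contributing nothing, and the sum
    over [n] telescopes to fluxes through the two ends, which the closure
    [c_(-1) = c_Nv = 0] makes zero ([sum_mode_mul_rhs]). *)

Set Implicit Arguments.
Unset Strict Implicit.

Import Order.TTheory GRing.Theory Num.Theory.
Import numFieldNormedType.Exports.

Local Open Scope classical_set_scope.
Local Open Scope ring_scope.

(** * Hermite polynomials *)

Lemma hermiteSS (R : realType) (n : nat) :
  hermite R n.+2 =
    2%:R *: ('X * hermite R n.+1) - (2 * n.+1)%N%:R *: hermite R n.
Proof. by []. Qed.

Lemma deriv_hermite (R : realType) (n : nat) :
  (hermite R n)^`() = (2 * n)%N%:R *: hermite R n.-1.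
Proof.
elim/ltn_ind: n => -[|[|n]] IH.
- by rewrite derivC muln0 scale0r.
- by rewrite derivZ derivX.
rewrite hermiteSS derivB !derivZ derivM derivX mul1r IH//= IH 1?ltnW//.
case: n IH => [|n] IH.
  by rewrite /= !muln0 !scale0r !scaler0 !subr0 -!mul_polyC; ring.
rewrite -!mul_polyC /= !natrM -!natr1; ring.
Qed.

(** Times the weight [exp (- x ^ 2)], the right-hand side is minus the derivative
    of the weighted [hermite R n], which is what integration by parts needs. *)
Lemma hermite_raising (R : realType) (n : nat) :
  hermite R n.+1 = 2%:R *: ('X * hermite R n) - (hermite R n)^`().
Proof.
case: n => [|n]; rewrite deriv_hermite ?hermiteSS//=.
by rewrite muln0 scale0r subr0 mulr1.
Qed.

(** The hypothesis is integration by parts against the weight [exp (- x ^ 2)].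
    It is all that is used of the functional: by [hermite_raising] it moves a
    derivative from the first factor to the second and lowers both indices by
    one, because [H_j' = 2 j H_(j-1)]. *)
Lemma hermite_orthogonal (R : realType) (L : {scalar {poly R}}) :
  (forall g : {poly R}, L (g^`() - 2%:R *: ('X * g)) = 0) ->
  forall i j : nat,
    L (hermite R i * hermite R j) = (i == j)%:R * (2 ^ i * i`!)%N%:R * L 1.
Proof.
move=> L0.
have parts i g : L (hermite R i.+1 * g) = L (hermite R i * g^`()).
  apply/eqP; rewrite -subr_eq0 -linearB -oppr_eq0 -linearN.
  rewrite -[X in _ == X](L0 (hermite R i * g)); apply/eqP; congr (L _).
  by rewrite hermite_raising derivM -!mul_polyC; ring.
elim=> [|i IH] [|j].
- by rewrite mulr1 !mul1r.
- by rewrite mulrC parts derivC mulr0 linear0 !mul0r.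
- by rewrite parts derivC mulr0 linear0 !mul0r.
rewrite parts deriv_hermite -scalerAr linearZ/= IH eqSS.
have [->|] := eqVneq i j; last by rewrite !mul0r mulr0.
by rewrite expnS factS !natrM /=; ring.
Qed.

(** * Polynomials against a Gaussian weight *)

(** The fundamental theorem of calculus on [[-n-1, n+1]] leaves boundary terms
    that vanish in the limit; integrability of the derivative lets the integrals
    over these intervals converge to the integral over the line. *)
Lemma Rintegral_derive_vanishing (R : realType) (F f : R -> R) :
  (forall x : R, is_derive x 1 F (f x)) -> continuous f ->
  (@lebesgue_measure R).-integrable setT (EFin \o f) ->
  F x @[x --> +oo] --> 0 -> F x @[x --> -oo] --> 0 ->
  \int[@lebesgue_measure R]_x f x = 0.
Proof.
move=> dF cf intf Fy FNy.
pose A n := `[- n.+1%:R : R, n.+1%:R]%classic.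
have mf := measurable_int _ intf.
have FTC n : (\int[@lebesgue_measure R]_(x in A n) (f x)%:E =
    (F n.+1%:R - F (- n.+1%:R))%:E)%E.
  have cF : continuous F.
    by move=> x; apply/differentiable_continuous/derivable1_diffP; case: (dF x).
  rewrite (@continuous_FTC2 _ _ F) ?gtrN//.
  - exact: continuous_subspaceT.
  - split; [by move=> x _; case: (dF x)| |].
    + exact/cvg_at_right_filter/cF.
    + exact/cvg_at_left_filter/cF.
  - by move=> x _; rewrite derive1E; case: (dF x).
have lim0 : (\int[@lebesgue_measure R]_(x in A n) (f x)%:E)%E @[n --> \oo]
    --> 0%E.
  under eq_fun do rewrite FTC.
  apply: cvg_EFin; first exact: nearW.
  rewrite -[X in _ --> X](subrr 0).
  have natSy : n.+1%:R @[n --> \oo] --> (+oo : set_system R).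
    by rewrite (cvg_shiftS (fun n => n%:R : R)); exact: cvgr_idn.
  apply: cvgB; first exact: cvg_comp natSy Fy.
  by apply: cvg_comp FNy; exact/cvgNrNy.
have limI : (\int[@lebesgue_measure R]_(x in A n) (f x)%:E)%E @[n --> \oo]
    --> (\int[@lebesgue_measure R]_x (f x)%:E)%E.
  under eq_fun do rewrite integral_mkcond.
  apply: (@dominated_cvg _ _ _ lebesgue_measure _ measurableT
    (fun n => (EFin \o f) \_ (A n)) (EFin \o f) (abse \o (EFin \o f))) => //.
  - move=> n; have mA : measurable (A n) by exact: measurable_itv.
    exact: (iffLR (measurable_restrictT _ mA)) (measurable_funTS mf).
  - move=> x _; apply: cvg_near_cst; near=> n.
    rewrite patchE mem_set// /A/= in_itv/= -ler_norml.
    near: n; apply: filterS (nbhs_infty_ger `|x|) => n /le_trans; apply.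
    by rewrite ler_nat.
  - exact: integrable_abse.
  - by move=> n x _; rewrite patchE; case: ifP => //= _; rewrite normr0 lee_fin.
by rewrite /Rintegral -(cvg_lim _ limI)// (cvg_lim _ lim0).
Unshelve. all: by end_near. Qed.

(** For a monomial, [|x| <= exp |x|] gives [|x| ^ i <= exp (i * |x|)], and
    [i * |x| <= (i ^ 2 + x ^ 2) / 2].  Half of the Gaussian exponent is kept
    in reserve, for integrability and for decay at infinity. *)
Lemma norm_horner_le_expR (R : realType) (p : {poly R}) :
  exists2 A, 0 <= A & forall x, `|p.[x]| <= A * expR (x ^+ 2 / 2).
Proof.
exists (\sum_(i < size p) `|p`_i| * expR (i%:R ^+ 2 / 2)).
  by apply: sumr_ge0 => i _; rewrite mulr_ge0 ?expR_ge0.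
move=> x; rewrite horner_coef mulr_suml; apply: le_trans (ler_norm_sum _ _ _) _.
apply: ler_sum => i _; rewrite normrM normrX -mulrA ler_wpM2l// -expRD.
have xexp : `|x| <= expR `|x| by apply: le_trans (expR_ge1Dx _); rewrite lerDr.
apply: (le_trans (lerXn2r i _ _ xexp)); rewrite ?nnegrE ?expR_ge0//.
rewrite -expRM_natl ler_expR -[x ^+ 2]real_normK ?num_real//.
by have := sqr_ge0 (i%:R - `|x|); lra.
Qed.

Definition poly_gauss (R : realType) (p : {poly R}) (x : R) : R :=
  p.[x] * gauss_fun x.

Lemma poly_gauss_le (R : realType) (p : {poly R}) :
  exists2 A, 0 <= A & forall x, `|poly_gauss p x| <= A * expR (- x ^+ 2 / 2).
Proof.
have [A A0 pA] := norm_horner_le_expR p; exists A => // x.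
rewrite /poly_gauss /gauss_fun normrM (ger0_norm (expR_ge0 _)).
apply: (le_trans (ler_wpM2r (expR_ge0 _) (pA x))).
by rewrite -mulrA -expRD ler_wpM2l// ler_expR; lra.
Qed.

Lemma cvgy_poly_gauss (R : realType) (p : {poly R}) :
  poly_gauss p x @[x --> +oo] --> 0.
Proof.
have [A A0 pA] := poly_gauss_le p.
apply/cvgr0Pnorm_le => e e0.
(* [- x ^ 2 / 2 <= 1 / 2 - x], the tangent at [x = 1]. *)
have : A * expR (2^-1) * expR (- x) @[x --> +oo] --> (0 : R).
  rewrite -[X in _ --> X](mulr0 (A * expR (2^-1))); apply: cvgMr.
  exact: cvgr_expR.
move=> /cvgr0Pnorm_le/(_ e e0); apply: filterS => x; apply: le_trans.
apply: (le_trans (pA x)); apply: le_trans (ler_norm _).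
rewrite -mulrA -expRD ler_wpM2l// ler_expR.
by have := sqr_ge0 (x - 1); lra.
Qed.

Lemma cvgNy_poly_gauss (R : realType) (p : {poly R}) :
  poly_gauss p x @[x --> -oo] --> 0.
Proof.
apply/cvgNy_compNP; apply: cvg_trans (cvgy_poly_gauss (p \Po - 'X)).
apply: near_eq_cvg; apply: nearW => x.
by rewrite /poly_gauss /gauss_fun /= horner_comp !hornerE sqrrN.
Qed.

Lemma is_derive_poly_gauss (R : realType) (p : {poly R}) (x : R) :
  is_derive x 1 (poly_gauss p) (poly_gauss (p^`() - 2%:R *: ('X * p)) x).
Proof.
have dg : is_derive x 1 (@gauss_fun R) (expR (- x ^+ 2) * (- (2 * x))).
  apply: (@is_derive1_comp R expR (fun x => - x ^+ 2)).
  rewrite (_ : (fun x => _) = horner (- 'X^2)); last first.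
    by apply/funext => y; rewrite !hornerE.
  by apply: is_derive_eq; rewrite derivN derivXn !hornerE /= mulr_natl.
change (is_derive x 1 (horner p * @gauss_fun R)
  (poly_gauss (p^`() - 2%:R *: ('X * p)) x)).
apply: is_derive_eq.
by rewrite /poly_gauss /gauss_fun /= !hornerE /GRing.scale /=; ring.
Qed.

Lemma continuous_poly_gauss (R : realType) (p : {poly R}) :
  continuous (poly_gauss p).
Proof.
move=> x; apply/differentiable_continuous/derivable1_diffP.
by case: (is_derive_poly_gauss p x).
Qed.

Lemma continuous_rescaled_poly_gauss (R : realType) (u a : R) (p : {poly R}) :
  continuous (fun v => poly_gauss p ((v - u) / a)).
Proof.
move=> v; apply: (cvg_comp (fun v => (v - u) / a)).
  by apply: cvgM; [apply: cvgB; [exact: cvg_id|exact: cvg_cst]|exact: cvg_cst].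
exact: continuous_poly_gauss.
Qed.

(** Dominated by a multiple of the normal density of mean [u] and standard
    deviation [a], whose exponent is half that of [poly_gauss]. *)
Lemma integrable_poly_gauss (R : realType) (u a : R) (p : {poly R}) : a != 0 ->
  (@lebesgue_measure R).-integrable setT
    (EFin \o (fun v => poly_gauss p ((v - u) / a))).
Proof.
move=> a0; have [A A0 pA] := poly_gauss_le p.
have := integrable_normal_pdf u a.
move=> /(integrableZl measurableT (A / normal_peak a)).
apply: le_integrable => //.
  have cf := @continuous_rescaled_poly_gauss _ u a p.
  have mg := @continuous_measurable_fun R _ cf.
  exact/measurable_EFinP.
move=> v _ /=; rewrite lee_fin normal_pdfE// mulrA divfK; last first.
  by rewrite gt_eqF// normal_peak_gt0.
apply: (le_trans (pA _)); apply: le_trans (ler_norm _).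
rewrite /normal_fun ler_wpM2l// ler_expR le_eqVlt; apply/predU1P; left.
by field.
Qed.

Definition gauss_moment (R : realType) (u a : R) (p : {poly R}) : R :=
  \int[@lebesgue_measure R]_v poly_gauss p ((v - u) / a).

Lemma gauss_moment_scalar (R : realType) (u a : R) : a != 0 ->
  scalar (@gauss_moment R u a).
Proof.
move=> a0 c p r; rewrite /gauss_moment.
transitivity (gauss_moment u a (c *: p) + gauss_moment u a r).
  rewrite -RintegralD//; [|exact: integrable_poly_gauss..].
  by apply: eq_Rintegral => v _; rewrite /poly_gauss hornerD mulrDl.
congr (_ + _); rewrite -RintegralZl//; last exact: integrable_poly_gauss.
by apply: eq_Rintegral => v _; rewrite /poly_gauss hornerZ mulrA.
Qed.

(** The integrand is the derivative in [v] of [a * poly_gauss p ((v - u) / a)],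
    the factor [a] cancelling the one of the chain rule. *)
Lemma gauss_moment_parts (R : realType) (u a : R) (p : {poly R}) : 0 < a ->
  gauss_moment u a (p^`() - 2%:R *: ('X * p)) = 0.
Proof.
move=> a0; apply: (@Rintegral_derive_vanishing _
  (fun v => a * poly_gauss p ((v - u) / a))).
- move=> v.
  have dxi : is_derive v 1 (fun v => (v - u) / a) a^-1.
    rewrite (_ : (fun v => _) = horner (a^-1 *: ('X - u%:P))); last first.
      by apply/funext => y; rewrite !hornerE mulrC.
    by apply: is_derive_eq; rewrite derivZ derivXsubC !hornerE.
  have := @is_derive1_comp _ _ (fun v => (v - u) / a) _ _ _
    (is_derive_poly_gauss p ((v - u) / a)) dxi.
  move=> /(is_deriveZ a)/is_derive_eq; apply.
  by rewrite /GRing.scale/= mulrCA mulfV ?gt_eqF// mulr1.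
- exact: continuous_rescaled_poly_gauss.
- by apply: integrable_poly_gauss; rewrite gt_eqF.
- rewrite -(mulr0 a); apply: cvgMr; apply: cvg_comp (cvgy_poly_gauss p).
  by apply: gt0_cvgMly; [rewrite invr_gt0|exact: cvg_addrr].
- rewrite -(mulr0 a); apply: cvgMr; apply: cvg_comp (cvgNy_poly_gauss p).
  by apply: gt0_cvgMlNy; [rewrite invr_gt0|exact: cvg_addrr_Ny].
Qed.

Lemma gauss_moment1 (R : realType) (u a : R) : 0 < a ->
  gauss_moment u a 1 = a * Num.sqrt pi.
Proof.
move=> a0.
(* [poly_gauss 1] is proportional to the normal density of standard deviation
   [a / sqrt 2]. *)
pose s := a / Num.sqrt 2.
have s2 : s ^+ 2 *+ 2 = a ^+ 2.
  by rewrite exprMn exprVn sqr_sqrtr// -mulr_natr divfK.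
have s0 : s != 0 by rewrite gt_eqF// divr_gt0 ?sqrtr_gt0.
have peak : normal_peak s = (a * Num.sqrt pi)^-1.
  rewrite /normal_peak -mulrnAl s2 sqrtrM ?sqr_ge0// sqrtr_sqr gtr0_norm//.
have := @integral_normal_pdf R u s; move/(congr1 fine) => /=.
rewrite normal_pdfE// peak /gauss_moment => N1.
have: \int[@lebesgue_measure R]_v
    ((a * Num.sqrt pi)^-1 * poly_gauss 1 ((v - u) / a)) = 1.
  rewrite -N1; apply: eq_Rintegral => v _.
  rewrite /poly_gauss /gauss_fun /normal_fun s2 hornerC mulrA.
  by rewrite mulr1 exprMn exprVn mulNr.
rewrite RintegralZl//; last by apply: integrable_poly_gauss; rewrite gt_eqF.
move/(congr1 ( *%R (a * Num.sqrt pi))).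
by rewrite mulVKf ?mulr1// mulf_neq0 ?gt_eqF// sqrtr_gt0 pi_gt0.
Qed.

(** Parseval's identity.  The product of two Hermite functions is a polynomial
    times [exp (- x ^ 2)], so the square of the expansion integrates to
    [gauss_moment] of the square of the polynomial [h] below. *)
Lemma Rintegral_sqr_hermite_expansion (R : realType) (N : nat) (c : 'I_N -> R)
    (u a : R) : 0 < a ->
  \int[@lebesgue_measure R]_v
    (\sum_(n < N) c n * psi n ((v - u) / a)) ^+ 2 = a * \sum_(n < N) c n ^+ 2.
Proof.
move=> a0.
pose L : {scalar {poly R}} := HB.pack (@gauss_moment R u a)
  (GRing.isLinear.Build R {poly R} R _ (@gauss_moment R u a)
     (gauss_moment_scalar u (lt0r_neq0 a0))).
pose k n : R := (Num.sqrt (Num.sqrt pi * 2 ^+ n * n`!%:R))^-1.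
have k2 n : k n * k n * (2 ^ n * n`!)%N%:R * Num.sqrt pi = 1.
  have w0 : 0 < Num.sqrt pi * 2 ^+ n * n`!%:R :> R.
    by rewrite !mulr_gt0 ?sqrtr_gt0 ?pi_gt0 ?exprn_gt0 ?ltr0n ?fact_gt0.
  rewrite -expr2 exprVn sqr_sqrtr ?ltW// natrM natrX -mulrA.
  rewrite [X in _ * X](_ : _ = Num.sqrt pi * 2 ^+ n * n`!%:R); last by ring.
  by rewrite mulVf ?gt_eqF.
pose h : {poly R} := \sum_(n < N) (c n * k n) *: hermite R n.
have -> : \int[@lebesgue_measure R]_v
    (\sum_(n < N) c n * psi n ((v - u) / a)) ^+ 2 = L (h * h).
  apply: eq_Rintegral => v _; set x := (v - u) / a.
  have -> : \sum_(n < N) c n * psi n x = h.[x] * expR (- x ^+ 2 / 2).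
    rewrite horner_sum mulr_suml; apply: eq_bigr => n _.
    by rewrite hornerZ /psi -/(k n) !mulrA.
  rewrite /poly_gauss /gauss_fun hornerM exprMn -expr2; congr (_ * _).
  by rewrite expr2 -expRD -splitr.
have Lorth i j : L (hermite R i * hermite R j) =
    (i == j)%:R * (2 ^ i * i`!)%N%:R * (a * Num.sqrt pi).
  rewrite hermite_orthogonal => [|g]; last exact: gauss_moment_parts.
  by congr (_ * _); exact: gauss_moment1.
(* Keeps simplification from unfolding [L] to an integral. *)
clearbody L; rewrite mulr_suml linear_sum mulr_sumr; apply: eq_bigr => n _.
rewrite mulr_sumr linear_sum (bigD1 n)//= big1 ?addr0 => [|i /negPf ni].
  rewrite -scalerAl -scalerAr !scalarZ Lorth eqxx mul1r.
  rewrite -[RHS]mulr1 -[X in _ = _ * X](k2 n); move: (_%:R) => w.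
  ring.
rewrite -scalerAl -scalerAr !scalarZ Lorth eq_sym.
by rewrite (_ : (i == n :> nat) = false)// !mul0r !mulr0.
Qed.

(** * Skew-symmetry of the semi-discrete system *)

(** [p < Nx] keeps the two nonzero ranges of the stencil, [1 <= k <= p / 2] and
    its mirror image, from overlapping. *)
Lemma fd_coef_opp (R : realType) (dx : R) (p Nx k : nat) :
  (p < Nx)%N -> (0 < k < Nx)%N -> fd_coef dx p Nx (Nx - k) = - fd_coef dx p Nx k.
Proof.
move=> pN /andP[k0 kN]; have half : (p./2 + p./2 <= p)%N.
  by rewrite addnn -[leqRHS]odd_double_half leq_addl.
rewrite /fd_coef (subKn (ltnW kN)) k0 subn_gt0 kN /=.
have [kp|pk] := leqP k p./2; last by case: ifP; rewrite ?opprK ?oppr0.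
by rewrite ifF//; apply/negbTE; lia.
Qed.

Lemma fd_matrix_skew (R : realType) (l : R) (p Nx : nat) :
  (p < Nx)%N -> (fd_matrix l p Nx)^T = - fd_matrix l p Nx.
Proof.
move=> pN; apply/matrixP => j k; rewrite !mxE.
wlog jk : j k / (j <= k)%N.
  move=> H; case/orP: (leq_total j k) => [|kj]; first exact: H.
  by rewrite (H _ _ kj) opprK.
have [->|] := eqVneq j k.
  rewrite subnKC 1?ltnW// modnn /fd_coef /= subn0 ifF ?oppr0//.
  by apply/negbTE; lia.
rewrite -val_eqE/= => njk; have kN := ltn_ord k.
have -> : ((j + (Nx - k)) %% Nx = Nx - (k - j))%N by rewrite modn_small; lia.
have -> : ((k + (Nx - j)) %% Nx = k - j)%N.
  by rewrite (_ : (_ + _ = k - j + Nx)%N) ?modnDr ?modn_small; lia.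
by apply: fd_coef_opp => //; lia.
Qed.

Lemma trmx_form (R : realType) (N : nat) (A : 'M[R]_N) (x y : 'cV[R]_N) :
  x^T *m A *m y = y^T *m A^T *m x.
Proof.
have tr11 (B : 'M[R]_1) : B^T = B by rewrite [B]mx11_scalar tr_scalar_mx.
by rewrite -[LHS]tr11 !trmx_mul trmxK mulmxA.
Qed.

Lemma skew_form0 (R : realType) (N : nat) (D : 'M[R]_N) (x : 'cV[R]_N) :
  D^T = - D -> x^T *m D *m x = 0.
Proof.
move=> skD; have := trmx_form D x x; rewrite skD mulmxN mulNmx.
move: (_ *m x) => B /matrixP BN; apply/matrixP => i j.
by have := BN i j; rewrite !mxE; lra.
Qed.

Lemma hadamard_diag (R : realType) (N : nat) (e y : 'cV[R]_N) :
  hadamard e y = diag_mx e^T *m y.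
Proof. by apply/colP => j; rewrite mul_diag_mx !mxE. Qed.

Lemma mode_ord (V : zmodType) (N : nat) (c : 'I_N -> V) (n : 'I_N) :
  mode c n%:Z = c n.
Proof. by rewrite /mode valK. Qed.

(** Exchange between the modes [n - 1] and [n]; it vanishes at [n = 0] because of
    its coefficient and at [n = Nv] because [mode c Nv = 0]. *)
Definition mode_flux (R : realType) (Nv Nx : nat) (A : 'M[R]_Nx)
    (c : 'I_Nv -> 'cV[R]_Nx) (n : nat) : 'M[R]_1 :=
  Num.sqrt (n%:R / 2) *: ((mode c n%:Z)^T *m A *m mode c (n%:Z - 1)).

(** [A] is the part of the generator that couples [c_n] to [c_(n-1)].  The
    coupling of [c_n] to [c_(n+1)] has the matrix [- A^T] instead, since [D] is
    skew-symmetric and the multiplication by [e] is symmetric: what [c_n]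
    receives from [c_(n+1)] is what [c_(n+1)] gives. *)
Lemma mode_mul_rhs (R : realType) (Nv Nx : nat) (D : 'M[R]_Nx)
    (q m u a : R) (c : 'I_Nv -> 'cV[R]_Nx) (e : 'cV[R]_Nx) (n : 'I_Nv) :
  D^T = - D ->
  let A := (q / (m * a)) *: diag_mx e^T - a *: D in
  (c n)^T *m swsr_rhs D q m u a c e n = mode_flux A c n - mode_flux A c n.+1.
Proof.
move=> skD A; rewrite /mode_flux /swsr_rhs.
have -> : n.+1%:Z - 1 = n%:Z by lia.
have -> : n%:Z + 1 = n.+1%:Z by lia.
rewrite mode_ord; set x := c n; set y := mode c (n%:Z - 1); set z := mode c _.
set s := Num.sqrt (n%:R / 2); set s' := Num.sqrt _.
have -> : z^T *m A *m x =
    (q / (m * a)) *: (x^T *m diag_mx e^T *m z) + a *: (x^T *m D *m z).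
  have -> : z^T *m A *m x = x^T *m A^T *m z by exact: trmx_form.
  have -> : A^T = (q / (m * a)) *: diag_mx e^T + a *: D.
    by rewrite /A raddfB/= !linearZ/= tr_diag_mx skD opprK.
  by rewrite mulmxDr mulmxDl -!scalemxAr -!scalemxAl.
have -> : x^T *m A *m y =
    (q / (m * a)) *: (x^T *m diag_mx e^T *m y) - a *: (x^T *m D *m y).
  by rewrite mulmxBr mulmxBl -!scalemxAr -!scalemxAl.
rewrite hadamard_diag mulmxDr mulmxN -scalemxAr !mulmxA mulmxBr !mulmxDr.
rewrite -!scalemxAr (skew_form0 _ skD).
move: (_ *m y) (_ *m z) (_ *m _ *m y) (_ *m D *m z) => P Q P' Q'.
apply/matrixP => i j; rewrite !mxE; ring.
Qed.

Lemma sum_mode_mul_rhs (R : realType) (Nv Nx : nat) (D : 'M[R]_Nx)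
    (q m u a : R) (c : 'I_Nv -> 'cV[R]_Nx) (e : 'cV[R]_Nx) :
  D^T = - D -> \sum_(n < Nv) (c n)^T *m swsr_rhs D q m u a c e n = 0.
Proof.
move=> skD; under eq_bigr do rewrite mode_mul_rhs// -opprB.
rewrite sumrN -(big_mkord xpredT (fun n => mode_flux _ c n.+1 - mode_flux _ c n)).
rewrite telescope_sumr// /mode_flux !mul0r sqrtr0 scale0r subr0.
by rewrite [mode c Nv]/mode insubF ?ltnn// trmx0 !mul0mx scaler0 oppr0.
Qed.

(** * The particle number and its derivative *)

Lemma particle_numberE (R : realType) (S : finType) (Nv Nx : nat) (l : R)
    (u alpha : S -> R) (C : S -> 'I_Nv -> R -> 'cV[R]_Nx) (s : S) :
  0 < alpha s ->
  particle_number l u alpha C s = fun t : R =>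
    grid_spacing l Nx * alpha s * \sum_(n < Nv) \sum_(j < Nx) C s n t j 0 ^+ 2.
Proof.
move=> a0; apply/funext => t; rewrite /particle_number /trapezoid -mulrA.
congr (_ * _); rewrite exchange_big mulr_sumr; apply: eq_bigr => j _.
exact: Rintegral_sqr_hermite_expansion.
Qed.

Lemma is_derive_coord (R : realType) (m n : nat) (M : R -> 'M[R]_(m, n))
    (t : R) (dM : 'M[R]_(m, n)) (i : 'I_m) (j : 'I_n) :
  is_derive t 1 M dM -> is_derive t 1 (fun x => M x i j) (dM i j).
Proof.
move=> [dMt <-]; apply: DeriveDef; first by move/derivable_mxP: dMt.
by rewrite derive_mx// mxE.
Qed.

Unset Implicit Arguments.

Theorem theorem7 (R : realType) (S : finType) (Nv Nx p : nat) (l : R)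
    (q m u alpha : S -> R) (I : interval R)
    (C : S -> 'I_Nv -> R -> 'cV[R]_Nx) (E : R -> 'cV[R]_Nx)
    (Nv_ge1 : (1 <= Nv)%N)
    (p_gt0 : (0 < p)%N) (p_even : ~~ odd p) (Nx_gtp : (p < Nx)%N)
    (l_gt0 : 0 < l)
    (m_gt0 : forall s : S, 0 < m s)
    (alpha_gt0 : forall s : S, 0 < alpha s)
    (sol : swsr_solution p l q m u alpha I C E) :
  forall (s : S) (t : R), t \in I ->
    is_derive t 1 (particle_number l u alpha C s) 0.
Proof.
move=> s t tI; rewrite particle_numberE//.
set rhs := swsr_rhs (fd_matrix l p Nx) (q s) (m s) (u s) (alpha s)
  (fun k => C s k t) (E t).
have dC n j : is_derive t 1 (fun x => C s n x j 0) (rhs n j 0).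
  exact/is_derive_coord/(swsr_evolution sol).
have rhs0 : \sum_(n < Nv) (C s n t)^T *m rhs n = 0.
  exact/sum_mode_mul_rhs/fd_matrix_skew.
(* Keeps [mxE] from unfolding [rhs]. *)
clearbody rhs; have dsum : is_derive t 1
    (\sum_(n < Nv) \sum_(j < Nx) (fun x => C s n x j 0) ^+ 2)
    (\sum_(n < Nv) \sum_(j < Nx) 2 * C s n t j 0 * rhs n j 0).
  (* The terms are found by instance resolution from [dC]. *)
  exact: is_derive_sum.
have -> : (fun x => grid_spacing l Nx * alpha s *
    \sum_(n < Nv) \sum_(j < Nx) C s n x j 0 ^+ 2) =
  (grid_spacing l Nx * alpha s) *:
    (\sum_(n < Nv) \sum_(j < Nx) (fun x => C s n x j 0) ^+ 2).
  apply/funext => x; rewrite fctE fct_sumE; congr (_ * _).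
  by apply: eq_bigr => n _; rewrite fct_sumE.
apply: is_derive_eq.
rewrite (_ : \sum_(n < Nv) _ = 0) ?scaler0//.
transitivity (2 * (\sum_(n < Nv) (C s n t)^T *m rhs n) 0 0).
  rewrite summxE mulr_sumr; apply: eq_bigr => n _; rewrite mxE mulr_sumr.
  by apply: eq_bigr => j _; rewrite mxE mulrA.
by rewrite rhs0 mxE mulr0.
Qed.
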